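(* Let $n\ge 8$ and let $G$ be a $2$-connected graph of order $n$. If $\rho(G)\ge n-4+\frac{2}{n-4}$, then $G$ contains a HIST.
   Context: All graphs are finite, simple and undirected. The order of a graph is its number of vertices. A graph of order at least $3$ is $2$-connected if it is connected and has no cut vertex. $\rho(G)$ denotes the spectral radius of $G$, i.e. the largest eigenvalue of its adjacency matrix. A homeomorphically irreducible spanning tree (HIST) of a connected graph $G$ is a spanning tree $T$ of $G$ such that $T$ has no vertex of degree $2$ (degree taken in $T$). *)

(* Defs.v *)
From HB Require Import structures.
From mathcomp Require Import all_boot all_order all_algebra.
From mathcomp Require Import boolp classical_sets reals.
From mathcomp Require polyrcf complex.

Set Implicit Arguments.
Unset Strict Implicit.
Unset Printing Implicit Defensive.

Import Order.TTheory GRing.Theory Num.Theory.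

Local Open Scope ring_scope.

Record sgraph (V : finType) := SGraph {
  adj :> rel V;
  adj_sym : symmetric adj;
  adj_irrefl : irreflexive adj
}.

Definition degree (V : finType) (G : sgraph V) (v : V) : nat :=
  #|[set w | G v w]|.

Definition connected (V : finType) (G : sgraph V) : Prop :=
  (0 < #|V|)%N /\ forall x y : V, connect G x y.

Definition num_components (V : finType) (G : sgraph V) : nat :=
  n_comp G predT.

Definition del_adj (V : finType) (G : sgraph V) (v : V) :
  rel {x : V | x != v} :=
  [rel x y | G (val x) (val y)].

Lemma del_adj_sym (V : finType) (G : sgraph V) (v : V) :
  symmetric (@del_adj V G v).
Proof. by move=> x y; rewrite /del_adj /= adj_sym. Qed.

Lemma del_adj_irrefl (V : finType) (G : sgraph V) (v : V) :
  irreflexive (@del_adj V G v).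
Proof. by move=> x; rewrite /del_adj /= adj_irrefl. Qed.

Definition del_vertex (V : finType) (G : sgraph V) (v : V) :
  sgraph {x : V | x != v} :=
  SGraph (@del_adj_sym V G v) (@del_adj_irrefl V G v).

(* An isolated vertex is not a cut vertex: the number of components has to
   increase. *)
Definition cut_vertex (V : finType) (G : sgraph V) (v : V) : Prop :=
  (num_components G < num_components (del_vertex G v))%N.

Definition two_connected (V : finType) (G : sgraph V) : Prop :=
  [/\ (3 <= #|V|)%N, connected G & forall v, ~ cut_vertex G v].

(* [ucycle] accepts the degenerate closed walks x and x, y of one or two
   vertices, so that only repetition-free cycles with at least three vertices
   are cycles of the graph. *)
Definition acyclic (V : finType) (G : sgraph V) : Prop :=
  forall c : seq V, (3 <= size c)%N -> ~ ucycle G c.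

Definition tree (V : finType) (T : sgraph V) : Prop :=
  connected T /\ acyclic T.

(* T has the same vertex type as G, hence is spanning. *)
Definition spanning_tree (V : finType) (G T : sgraph V) : Prop :=
  subrel T G /\ tree T.

Definition hist (V : finType) (G T : sgraph V) : Prop :=
  spanning_tree G T /\ forall v, degree T v <> 2%N.

Definition has_hist (V : finType) (G : sgraph V) : Prop :=
  exists T : sgraph V, hist G T.

Definition adj_mx (R : nzRingType) (V : finType) (G : sgraph V) : 'M[R]_#|V| :=
  \matrix_(i, j) (G (enum_val i) (enum_val j))%:R.

(* The supremum is a maximum, see spectral_radiusP. *)
Definition spectral_radius (R : realType) (V : finType) (G : sgraph V) : R :=
  sup [set a : R | eigenvalue (adj_mx R G) a]%classic.

Section SymmetricEigenvalue.

Import complex.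

Lemma symmetric_eigenvalue (R : rcfType) n (A : 'M[R]_n) :
  (0 < n)%N -> A^T = A ->
  exists a, eigenvalue A a.
Proof.
move=> n0 sA.
pose f := (real_complex R).
have [l hl] := eigenvalue_closed (map_mx f A) n0.
case/eigenvalueP: (hl) => v hv v0.
pose w := map_mx Num.conj v.
have E : l *: (v *m w^T) = (Num.conj l) *: (v *m w^T).
  rewrite scalemxAl -hv -mulmxA.
  have -> : map_mx f A *m w^T = Num.conj l *: w^T.
    rewrite -[map_mx f A]trmxK -trmx_mul matrix.map_trmx sA.
    have -> : map_mx f A = map_mx Num.conj (map_mx f A).
      apply/matrixP => i j; rewrite !mxE; apply/esym/CrealP.
      by apply/complex_realP; eexists.
    by rewrite /w -map_mxM hv map_mxZ linearZ.
  by rewrite -scalemxAr.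
have N : (v *m w^T) 0 0 != 0.
  have [j vj] : exists j, v 0 j != 0 by exact/rV0Pn.
  rewrite mxE psumr_neq0; last by move=> i _; rewrite !mxE mul_conjC_ge0.
  by apply/hasP; exists j; rewrite ?mem_index_enum //= !mxE mul_conjC_gt0.
have /complex_realP : l \is Num.real.
  move/matrixP/(_ 0 0): E; rewrite !(mxE, mulmxE).
  rewrite CrealE => E; apply/eqP/esym/(mulIf N).
  by rewrite !mxE in N *.
case=> a la; exists a.
move: hl; rewrite la !eigenvalue_root_char -map_char_poly.
by rewrite fmorph_root.
Qed.

End SymmetricEigenvalue.

Lemma spectral_radiusP (R : realType) (V : finType) (G : sgraph V) :
  (0 < #|V|)%N ->
  eigenvalue (adj_mx R G) (spectral_radius R G) /\
  forall a, eigenvalue (adj_mx R G) a -> a <= spectral_radius R G.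
Proof.
move=> V0; set A := adj_mx R G.
have [a0 ha0] : exists a, eigenvalue A a.
  apply: symmetric_eigenvalue => //.
  by apply/matrixP => i j; rewrite !mxE adj_sym.
have pn0 : char_poly A != 0 by rewrite monic_neq0 ?char_poly_monic.
have sP x : eigenvalue A x = (x \in polyrcf.rootsR (char_poly A)).
  by rewrite eigenvalue_root_char -(polyrcf.roots_on_rootsR pn0 x) in_itv.
move: (polyrcf.rootsR _) sP => s sP.
pose m := \big[Num.max/a0]_(x <- s) x.
have ms : m \in s.
  rewrite /m big_seq; elim/big_ind: _ => //; first by rewrite -sP.
  by move=> x y; case: leP.
have mub x : x \in s -> x <= m by move=> xs; apply: le_bigmax_seq.
have -> : spectral_radius R G = m.
  apply/le_anti/andP; split.
    apply: ge_sup; first by exists a0.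
    by move=> x /=; rewrite sP; exact: mub.
  apply: ub_le_sup; last by rewrite /= sP.
  by exists m => x /=; rewrite sP; exact: mub.
by rewrite sP; split=> // a; rewrite sP; exact: mub.
Qed.

(* Main.v *)
Require Import Defs.
From mathcomp Require Import all_boot all_order all_algebra boolp reals.
From mathcomp Require Import zify lra.

Set Implicit Arguments.
Unset Strict Implicit.
Unset Printing Implicit Defensive.

Import Order.TTheory GRing.Theory Num.Theory.
Local Open Scope ring_scope.

(* Let rho be the spectral radius.  If x is an eigenvector for rho then |x| is
   nonnegative, nonzero and satisfies rho |x| <= A |x|.  Summing this gives a
   vertex v of degree at least rho, hence at least n - 3; summing it against
   the degrees gives rho (rho - 1) <= 2 m - 2 n + 2, as in the theorem of Hong,
   Shu and Fang, hence 2 m >= (n - 3) (n - 4) + 10, since all degrees are at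
   least 2.  If v misses no vertex, the star at v is a HIST.  If v misses one or
   two vertices, a tree obtained from the star at v by turning one or two other
   vertices into hubs of degree at least 3 is a HIST; when no such tree exists,
   the neighbours of the missed vertices have so few neighbours in N(v) that
   the number of edges is too small. *)

(** * Eigenvalue bounds from a nonnegative test vector *)

Lemma degree_sum (V : finType) (G : sgraph V) (v : V) :
  degree G v = (\sum_(w | G v w) 1)%N.
Proof. by rewrite sum1_card /degree cardsE. Qed.

(** Triangle inequality in the coordinates of the eigenvector equation. The function [f] then does
    the work of a Perron vector. *)
Lemma eigenvalue_subharmonic (R : realType) (V : finType) (G : sgraph V) (a : R) :
  eigenvalue (adj_mx R G) a ->
  exists f : V -> R, [/\ forall y, 0 <= f y, exists y, 0 < f y
    & forall y, a * f y <= \sum_(z | G y z) f z].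
Proof.
case/eigenvalueP => x xA x0.
exists (fun y => `|x 0 (enum_rank y)|); split=> [y||y]; first exact: normr_ge0.
  have /rV0Pn [j xj] := x0.
  by exists (enum_val j); rewrite enum_valK normr_gt0.
have -> : \sum_(z | G y z) `|x 0 (enum_rank z)| =
    \sum_j `|x 0 j * adj_mx R G j (enum_rank y)|.
  rewrite big_mkcond (reindex (fun j : 'I_#|V| => enum_val j)) /=; last first.
    exact/onW_bij/enum_val_bij.
  apply: eq_bigr => j _; rewrite enum_valK mxE enum_rankK adj_sym normrM.
  by case: (G _ _); rewrite ?normr1 ?normr0 ?mulr1 ?mulr0.
apply: le_trans (ler_norm_sum _ _ _).
have /matrixP/(_ 0 (enum_rank y)) := xA; rewrite !mxE => ->.
by rewrite normrM ler_wpM2r ?ler_norm.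
Qed.

(** If [q] stayed below [c] everywhere, the sum would be strictly smaller, thanks to the point where
    [f] is positive. This turns a summed inequality into one at a single vertex. *)
Lemma weighted_mean_le (R : realFieldType) (V : finType) (f q : V -> R) (c : R) :
  (forall y, 0 <= f y) -> (exists y, 0 < f y) ->
  c * (\sum_y f y) <= \sum_y q y * f y -> exists y, c <= q y.
Proof.
move=> f0 [y0 fy0] le_c.
have [/existsP[y cy]|/existsPn ncq] := boolP [exists y, c <= q y]; first by exists y.
move: le_c; rewrite leNgt => /negP[]; rewrite mulr_sumr.
rewrite (bigD1 y0) //= [ltRHS](bigD1 y0) //=.
apply: ltr_leD; first by rewrite ltr_pM2r // ltNge.
by apply: ler_sum => y _; rewrite ler_wpM2r // ltW // ltNge.
Qed.

Section SpectralBounds.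

Variables (R : realType) (V : finType) (G : sgraph V) (a : R).
Hypothesis eig_a : eigenvalue (adj_mx R G) a.

(** Symmetry of the adjacency matrix moves it from [f] to the weight [q]. *)
Lemma sum_adj_weight (q f : V -> R) :
  \sum_y q y * (\sum_(z | G y z) f z) = \sum_z (\sum_(y | G z y) q y) * f z.
Proof.
under eq_bigr do rewrite mulr_sumr.
rewrite (exchange_big_dep predT) //=; apply: eq_bigr => z _.
by rewrite mulr_suml; apply: eq_bigl => y; rewrite adj_sym.
Qed.

Lemma eigenvalue_le_degree : exists v, a <= (degree G v)%:R.
Proof.
have [f [f0 f_neq0 le_af]] := eigenvalue_subharmonic eig_a.
apply: (weighted_mean_le f0 f_neq0); rewrite mulr_sumr.
apply: (@le_trans _ _ (\sum_y 1 * \sum_(z | G y z) f z)).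
  by apply: ler_sum => y _; rewrite mul1r.
rewrite (sum_adj_weight (fun=> 1)); apply: ler_sum => z _.
by rewrite degree_sum natr_sum.
Qed.

(** The subharmonic inequality is weighted by the degrees d. With F, P, S the sums of f, of d f and
    of d (A f), one has a F <= P and a P <= S. Hence S - P >= (a - 1) P >= a (a - 1) F, where the
    last inequality uses 1 <= a. *)
Lemma eigenvalue_le_row_sum : 1 <= a ->
  exists v, a * (a - 1) <= (\sum_(w | G v w) degree G w)%:R - (degree G v)%:R.
Proof.
move=> a1; have [f [f0 f_neq0 le_af]] := eigenvalue_subharmonic eig_a.
apply: (weighted_mean_le f0 f_neq0).
under [leRHS]eq_bigr do rewrite natr_sum mulrBl.
rewrite sumrB -(sum_adj_weight (fun w => (degree G w)%:R)).
have le1 : a * \sum_y f y <= \sum_y (degree G y)%:R * f y.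
  rewrite mulr_sumr.
  apply: (@le_trans _ _ (\sum_y 1 * \sum_(z | G y z) f z)).
    by apply: ler_sum => y _; rewrite mul1r.
  rewrite (sum_adj_weight (fun=> 1)); apply: ler_sum => z _.
  by rewrite degree_sum natr_sum.
have le2 : a * (\sum_y (degree G y)%:R * f y) <=
    \sum_y (degree G y)%:R * \sum_(z | G y z) f z.
  rewrite mulr_sumr; apply: ler_sum => y _.
  by rewrite mulrCA ler_wpM2l.
move: (\sum_y (degree G y)%:R * \sum_(z | G y z) f z) le2 => S.
move: (\sum_y _) (\sum_y _) le1 => F P; nra.
Qed.

End SpectralBounds.

(** * From the spectral condition to a large degree and many edges *)

Section DenseGraph.

Variables (V : finType) (G : sgraph V).
Hypothesis min_degree : forall x, (1 < degree G x)%N.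

(** Each of the vertices outside the closed neighbourhood of [v] has degree at least 2. *)
Lemma sum_degree_neighbours (v : V) :
  (\sum_(w | G v w) degree G w + degree G v + 2 * (#|V| - (degree G v).+1)
   <= \sum_x degree G x)%N.
Proof.
rewrite [leqRHS](bigID (G v)) /= -addnA leq_add2l.
rewrite [leqRHS](bigD1 v) ?adj_irrefl //= leq_add2l.
have -> : (#|V| - (degree G v).+1 = #|[pred i | ~~ G v i & i != v]|)%N.
  have := cardsC (v |: [set w | G v w]).
  rewrite cardsU1 inE adj_irrefl add1n -/(degree G v) => <-.
  rewrite addKn -(cardsE [pred i | _ & _]); apply: eq_card => i.
  by rewrite !inE negb_or andbC.
by rewrite mulnC -sum_nat_const; apply: leq_sum.
Qed.

Lemma spectral_degree_bounds (R : realType) (a : R) :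
  (8 <= #|V|)%N -> eigenvalue (adj_mx R G) a ->
  #|V|%:R - 4 + 2 / (#|V|%:R - 4) <= a ->
  (exists v, #|V| <= degree G v + 3)%N /\
  ((#|V| - 3) * (#|V| - 4) + 10 <= \sum_x degree G x)%N.
Proof.
move=> n8 eig_a le_a.
have n8R : 8 <= #|V|%:R :> R by rewrite (ler_nat _ 8).
have k0 : 0 < #|V|%:R - 4 :> R by lra.
set k : R := #|V|%:R - 4 in le_a k0.
have [t tE] : exists t : R, t = 2 / k by eexists.
have t0 : 0 < t by rewrite tE divr_gt0.
have tk : t * k = 2 by rewrite tE divfK // gt_eqF.
rewrite -tE in le_a.
have kE : #|V|%:R = k + 4 by rewrite /k subrK.
split.
  have [v av] := eigenvalue_le_degree eig_a; exists v.
  rewrite -ltnS -(ltr_nat R) -addn1 !natrD; lra.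
have [v] := eigenvalue_le_row_sum eig_a ltac:(lra).
have := sum_degree_neighbours v.
have : (degree G v < #|V|)%N.
  have := max_card (mem (v |: [set w | G v w])).
  by rewrite cardsU1 inE adj_irrefl.
move: (\sum_(w | _) _)%N (\sum_x _)%N (degree G v) => S D d ltd leD le_row.
(* Since t k = 2, (k + t) (k + t - 1) = k (k - 1) + 4 + t^2 - t, and t^2 - t > -1. *)
have {le_a} le_row2 : k * (k - 1) + 3 < S%:R - d%:R.
  apply: lt_le_trans le_row; nra.
(* Over the integers the strict inequality gains one unit. In S + d + 2 (n - d - 1) the degree d
   then cancels, which leaves (n - 4) (n - 5) + 2 n + 2 = (n - 3) (n - 4) + 10. *)
have lt_row : ((#|V| - 4) * (#|V| - 5) + 3 + d < S)%N.
  rewrite -(ltr_nat R) !natrD natrM !natrB ?(leq_trans _ n8) //.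
  move: le_row2; rewrite kE; lra.
nia.
Qed.

End DenseGraph.

(** * Minimum degree of a 2-connected graph *)

Lemma connect_neighbour (V : finType) (e : rel V) (x y : V) :
  connect e x y -> x != y -> exists z, e x z.
Proof.
case/connectP => -[|z p] /= => [_ ->|/andP[xz _] _ _]; first by rewrite eqxx.
by exists z.
Qed.

(** Were [w] the only neighbour of [x], deleting [w] would isolate [x] from some third vertex, so
    [w] would be a cut vertex. *)
Lemma two_connected_min_degree (V : finType) (G : sgraph V) :
  two_connected G -> forall x, (1 < degree G x)%N.
Proof.
case=> V3 [_ conG] noncut x; rewrite ltnNge; apply/negP => dx1.
have ex_avoid (w : V) : exists z, (z != x) && (z != w).
  apply/existsP; apply: contraT => /existsPn H.
  have : (#|V| <= #|[set x; w]|)%N.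
    apply/subset_leq_card/subsetP => z _.
    by have := H z; rewrite !inE; do 2!case: eqP.
  by rewrite cards2 leqNgt (leq_trans _ V3) // ltnS; case: (_ != _).
have [z0 /andP[z0x _]] := ex_avoid x.
have [w xw] : exists w, G x w.
  by apply: connect_neighbour (conG x z0) _; rewrite eq_sym.
have [z /andP[zx zw]] := ex_avoid w.
apply: (noncut w); rewrite /cut_vertex.
have -> : num_components G = 1%N.
  rewrite -(n_comp_connect (sym_connect_sym (adj_sym G)) x).
  by apply: eq_n_comp_r => y; rewrite !inE conG.
have xw' : x != w by apply: contraTneq xw => ->; rewrite adj_irrefl.
pose x' : {y | y != w} := Sub x xw'; pose z' : {y | y != w} := Sub z zw.
have symH := sym_connect_sym (adj_sym (del_vertex G w)).
rewrite ltnNge; apply/negP => /card_le1_eqP eq_root.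
have /(fingraph.rootP symH) : fingraph.root (del_vertex G w) x' =
    fingraph.root (del_vertex G w) z'.
  by apply: eq_root; rewrite inE /= roots_root.
case/connect_neighbour; first by rewrite -val_eqE /= eq_sym.
move=> y /=; rewrite /del_adj /= => xy.
have /card_le1_eqP := dx1 => /(_ w (val y)).
rewrite !inE => /(_ xw xy) wy.
by have /eqP := valP y; apply.
Qed.

(** * Spanning trees given by a parent map *)

Section HubTree.

Variables (V : finType) (G : sgraph V) (r : V) (hs : seq V) (p : V -> V).

(** Here [r] is the root, [p] the parent map and [hs] the list of the other hubs. As [index] returns
    the length of the list for a vertex outside it, [parent_index] says at once that every parent is
    in [r :: hs] and that it precedes its children there. *)
Definition parent_rel : rel V :=
  [rel x y | (x != r) && (p x == y) || (y != r) && (p y == x)].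

Hypothesis parent_adj : forall x, x != r -> G x (p x).
Hypothesis parent_index :
  forall x, x != r -> (index (p x) (r :: hs) < index x (r :: hs))%N.

Lemma parent_rel_sym : symmetric parent_rel.
Proof. by move=> x y; rewrite /parent_rel /= orbC. Qed.

Lemma parent_rel_irrefl : irreflexive parent_rel.
Proof.
move=> x; rewrite /parent_rel /= orbb; apply/negP => /andP[/parent_index].
by move=> /[swap] /eqP ->; rewrite ltnn.
Qed.

Definition parent_graph : sgraph V := SGraph parent_rel_sym parent_rel_irrefl.

(** Iterating [p] lowers the index until [r] is reached, whence connectedness. A cycle fails at a
    vertex of maximal index; ties between leaves do no harm, because parents have strictly smaller
    index. *)
Lemma parent_graph_tree : spanning_tree G parent_graph.
Proof.
split=> [x y /= /orP[] /andP[/parent_adj]|].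
- by move=> /[swap] /eqP ->.
- by move=> /[swap] /eqP ->; rewrite adj_sym.
split.
  split; first by apply/card_gt0P; exists r.
  have conr x : connect parent_graph x r.
    have [m] := ubnP (index x (r :: hs)); elim: m x => // m IH x xm.
    have [->|xr] := eqVneq x r; first exact: connect0.
    apply: connect_trans (IH (p x) _); last first.
      by rewrite -ltnS (leq_trans _ xm) // ltnS parent_index.
    by apply: connect1; rewrite /= /parent_rel /= xr eqxx.
  move=> x y; apply: connect_trans (conr x) _.
  by rewrite (sym_connect_sym parent_rel_sym).
move=> c c3 /andP[cyc_c uniq_c].
have [x0 x0c] : exists x, x \in c.
  by case: (c) c3 => // x s _; exists x; rewrite inE eqxx.
(* Both neighbours in the cycle of a vertex of maximal index are its parent. *)
have [x xc /= xmax] := arg_maxnP (fun x => index x (r :: hs)) x0c.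
have pE y : y \in c -> parent_rel x y -> p x = y.
  move=> yc /orP[/andP[_ /eqP]//|/andP[/parent_index]].
  by move=> /[swap] /eqP -> ; rewrite ltnNge (xmax y yc).
have [i s sE] := rot_to xc.
have memE : c =i x :: s by move=> y; rewrite -sE mem_rot.
move: c3 cyc_c uniq_c; rewrite -(rot_cycle i) -(rot_uniq i) -(size_rot i) sE.
case: s {sE} memE => [//|y s]; case/lastP: s => [//|s z] memE _.
rewrite /= rcons_path last_rcons => /andP[xy /andP[_ zx]].
rewrite -(pE y) ?memE ?inE ?eqxx ?orbT // -(pE z) ?mem_rcons ?inE ?eqxx //.
  by rewrite andbF.
- by rewrite memE !inE mem_rcons inE eqxx !orbT.
- by rewrite parent_rel_sym.
Qed.

(** A child of [x] would need an index above the length of the list, so only the parent is adjacent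
    to [x]. *)
Lemma parent_graph_leaf (x : V) :
  x \notin r :: hs -> degree parent_graph x = 1%N.
Proof.
move=> xhs; have xr : x != r by apply: contraNneq xhs => ->; rewrite inE eqxx.
rewrite -(cards1 (p x)); apply: eq_card => y; rewrite !inE /= /parent_rel /= xr /=.
rewrite [y == p x]eq_sym; case: eqP => //= _.
apply/negbTE/negP => /andP[/parent_index].
by move=> /[swap] /eqP ->; rewrite (memNindex xhs) ltnNge index_size.
Qed.

Lemma parent_graph_hist :
  {in r :: hs, forall x, (2 < degree parent_graph x)%N} -> has_hist G.
Proof.
move=> hub_deg; exists parent_graph; split; first exact: parent_graph_tree.
move=> x; have [/hub_deg|/parent_graph_leaf ->//] := boolP (x \in r :: hs).
by move=> /[swap] ->.
Qed.


End HubTree.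

Lemma uniq_size_leq_degree (V : finType) (G : sgraph V) (x : V) (s : seq V) :
  uniq s -> {in s, forall y, G x y} -> (size s <= degree G x)%N.
Proof.
move=> /card_uniqP <- sG; apply/subset_leq_card/subsetP => y /sG.
by rewrite inE.
Qed.

Lemma set_size_leq_degree (V : finType) (G : sgraph V) (x : V) (s : seq V) :
  (forall y, y \notin s -> G x y) -> (#|V| - size s <= degree G x)%N.
Proof.
move=> sG; apply: (@leq_trans #|[predC s]|).
  by rewrite -(cardC (mem s)) leq_subLR leq_add2r card_size.
by apply/subset_leq_card/subsetP => y; rewrite !inE => /sG.
Qed.

Lemma neqF (T : eqType) (x y : T) :
  x != y -> ((x == y) = false) * ((y == x) = false).
Proof. by move=> xy; split; apply/negbTE; rewrite // eq_sym. Qed.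

(** * HISTs with one, two or three hubs *)

Section Hubs.

Variables (V : finType) (G : sgraph V) (v : V).
Hypothesis V8 : (8 <= #|V|)%N.

Lemma star_hist : (forall z, z != v -> G v z) -> has_hist G.
Proof.
move=> vG.
have padj z : z != v -> G z v by move=> zv; rewrite adj_sym vG.
have pidx z : z != v -> (index v (v :: [::]) < index z (v :: [::]))%N.
  by move=> zv; rewrite /= eqxx eq_sym (negbTE zv).
apply: (parent_graph_hist padj (parent_index := pidx)) => x.
rewrite inE => /eqP ->.
apply: leq_trans (set_size_leq_degree (s := [:: v]) _).
  by rewrite /= ltn_subRL (leq_trans _ V8).
by move=> z; rewrite inE => zv; rewrite /= /parent_rel /= zv eqxx orbT.
Qed.

(** The vertices [a1] and [a2] hang from [w], and all others, [w] included, hang from [v]. *)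
Lemma two_hub_hist (w a1 a2 : V) :
  uniq [:: v; w; a1; a2] -> G w a1 -> G w a2 ->
  (forall z, z \notin [:: v; a1; a2] -> G v z) -> has_hist G.
Proof.
rewrite /= !inE !negb_or -!andbA => /and4P[vw va1 va2 /and4P[wa1 wa2 a12 _]].
move=> wGa1 wGa2 vG; pose p z := if z \in [:: a1; a2] then w else v.
have pw : p w = v by rewrite /p !inE (negbTE wa1) (negbTE wa2).
have pa1 : p a1 = w by rewrite /p !inE eqxx.
have pa2 : p a2 = w by rewrite /p !inE eqxx orbT.
have padj z : z != v -> G z (p z).
  move=> zv; rewrite adj_sym /p; case: ifP => [|zN].
    by rewrite !inE => /orP[] /eqP ->.
  by apply: vG; rewrite inE negb_or zv zN.
have pidx z : z != v ->
    (index (p z) (v :: [:: w]) < index z (v :: [:: w]))%N.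
  move=> zv; have vz : v == z = false by rewrite eq_sym (negbTE zv).
  rewrite /p; case: ifP => [|_]; last by rewrite /= eqxx vz.
  by rewrite !inE => /orP[] /eqP E; move: vz; rewrite E /= eqxx => ->;
    rewrite (negbTE vw) ?(negbTE wa1) ?(negbTE wa2).
apply: (parent_graph_hist padj (parent_index := pidx)) => x.
rewrite !inE => /orP[] /eqP ->.
  apply: leq_trans (set_size_leq_degree (s := [:: v; a1; a2]) _).
    by rewrite /= ltn_subRL (leq_trans _ V8).
  move=> z; rewrite inE negb_or => /andP[zv zN].
  by rewrite /= /parent_rel /= zv /p (negbTE zN) eqxx orbT.
apply: (@uniq_size_leq_degree _ _ _ [:: v; a1; a2]).
  by rewrite /= !inE negb_or va1 va2 a12.
move=> z; rewrite !inE /= /parent_rel /= => /or3P[] /eqP ->.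
- by rewrite eq_sym vw pw eqxx.
- by rewrite pa1 [a1 == v]eq_sym va1 eqxx orbT.
- by rewrite pa2 [a2 == v]eq_sym va2 eqxx orbT.
Qed.

(** The pair [a1], [a2] hangs from [w1], the pair [b1], [b2] from [w2], and the rest from [v]. The
    hypotheses leave open whether [w2] is one of [a1], [a2]: if it is, the hubs form a path [v],
    [w1], [w2]; otherwise [w2] also hangs from [v]. *)
Lemma three_hub_hist (w1 w2 a1 a2 b1 b2 : V) :
  uniq [:: v; w1; a1; a2; b1; b2] -> w2 \notin [:: v; w1; b1; b2] ->
  G w1 a1 -> G w1 a2 -> G w2 b1 -> G w2 b2 ->
  (forall z, z \notin [:: v; a1; a2; b1; b2] -> G v z) -> has_hist G.
Proof.
rewrite /= !inE !negb_or -!andbA.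
case/and5P=> /neqF vw1 /neqF va1 /neqF va2 /neqF vb1.
case/and5P=> /neqF vb2 /neqF w1a1 /neqF w1a2 /neqF w1b1.
case/and5P=> /neqF w1b2 /neqF a12 /neqF a1b1 /neqF a1b2.
case/and4P=> /neqF a2b1 /neqF a2b2 /neqF b12 _.
case/and4P=> /neqF w2v /neqF w2w1 /neqF w2b1 /neqF w2b2.
have neqE := (vw1, va1, va2, vb1, vb2, w1a1, w1a2, w1b1, w1b2, a12, a1b1, a1b2,
  a2b1, a2b2, b12, (w2v, w2w1, w2b1, w2b2)).
move=> {vw1 va1 va2 vb1 vb2 w1a1 w1a2 w1b1 w1b2 a12 a1b1 a1b2}.
move=> {a2b1 a2b2 b12 w2v w2w1 w2b1 w2b2}.
move=> w1a1 w1a2 w2b1 w2b2 vG.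
pose p z := if z \in [:: a1; a2] then w1 else if z \in [:: b1; b2] then w2 else v.
have padj z : z != v -> G z (p z).
  move=> zv; rewrite adj_sym /p.
  case: ifP => [|zN]; first by rewrite !inE => /orP[] /eqP ->.
  case: ifP => [|zN']; first by rewrite !inE => /orP[] /eqP ->.
  by apply: vG; move: zN zN'; rewrite !inE (negbTE zv) /= orbA => -> ->.
have pw1 : p w1 = v by rewrite /p !inE !neqE.
have pa1 : p a1 = w1 by rewrite /p !inE eqxx.
have pa2 : p a2 = w1 by rewrite /p !inE eqxx orbT.
have pb1 : p b1 = w2 by rewrite /p !inE !neqE eqxx.
have pb2 : p b2 = w2 by rewrite /p !inE !neqE eqxx.
have pw2 : p w2 \in [:: v; w1].
  by rewrite /p; case: ifP; rewrite !inE ?neqE ?eqxx ?orbT.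
have pidx z : z != v ->
    (index (p z) (v :: [:: w1; w2]) < index z (v :: [:: w1; w2]))%N.
  move=> zv; have vz : v == z = false by rewrite eq_sym (negbTE zv).
  have [->|zw1] := eqVneq z w1; first by rewrite pw1 /= eqxx neqE.
  have [->|zw2] := eqVneq z w2.
    by move: pw2; rewrite !inE => /orP[] /eqP ->; rewrite /= ?eqxx !neqE.
  (* A vertex that is no hub gets the default index 3, above that of any hub. *)
  have -> : index z [:: v; w1; w2] = 3%N.
    by rewrite /= vz ![_ == z]eq_sym (negbTE zw1) (negbTE zw2).
  by rewrite /p; do 2?case: ifP => _; rewrite /= eqxx; do 2?case: (_ == _).
apply: (parent_graph_hist padj (parent_index := pidx)) => x.
rewrite !inE => /or3P[] /eqP ->.
(* Only four vertices other than [v] hang elsewhere, so order at least 8 leaves [v] three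
   children. *)
- apply: leq_trans (set_size_leq_degree (s := [:: v; a1; a2; b1; b2]) _).
    by rewrite /= ltn_subRL (leq_trans _ V8).
  move=> z; rewrite inE negb_or => /andP[zv zN]; rewrite /= /parent_rel /= zv.
  have -> : p z = v; last by rewrite eqxx orbT.
  by move: zN; rewrite /p !inE orbA negb_or => /andP[/negbTE -> /negbTE ->].
- apply: (@uniq_size_leq_degree _ _ _ [:: v; a1; a2]).
    by rewrite /= !inE !neqE.
  by move=> z; rewrite !inE /= /parent_rel /= => /or3P[] /eqP ->;
    rewrite ?pw1 ?pa1 ?pa2 ?eqxx !neqE ?orbT.
- apply: (@uniq_size_leq_degree _ _ _ [:: p w2; b1; b2]).
    by move: pw2; rewrite !inE => /orP[] /eqP ->; rewrite /= !inE !neqE.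
  by move=> z; rewrite !inE /= /parent_rel /= => /or3P[] /eqP ->;
    rewrite ?pb1 ?pb2 ?eqxx !neqE ?orbT.
Qed.

End Hubs.

(** * Degrees into a vertex set and edge counts *)

Section DegreeIn.

Variables (V : finType) (G : sgraph V).

(** A sum of truth values, so that splitting [S] and counting edges from both ends become
    manipulations of sums. *)
Definition degree_in (S : {set V}) (x : V) : nat := (\sum_(y in S) G x y)%N.

Lemma degree_in_card (S : {set V}) (x : V) :
  degree_in S x = #|[set y in S | G x y]|.
Proof.
rewrite -sum1dep_card /degree_in big_mkcondr.
by apply: eq_bigr => y _; case: (G x y).
Qed.

Lemma degree_in_set1 (x y : V) : degree_in [set y] x = G x y.
Proof. by rewrite /degree_in big_set1. Qed.

Lemma degree_inU (S T : {set V}) (x : V) :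
  [disjoint S & T] -> degree_in (S :|: T) x = (degree_in S x + degree_in T x)%N.
Proof.
by move=> dST; rewrite /degree_in -bigU //; apply: eq_bigl => y; rewrite !inE.
Qed.

Lemma degree_inT (x : V) : degree_in setT x = degree G x.
Proof. by rewrite degree_in_card; apply: eq_card => y; rewrite !inE. Qed.

Lemma degree_inD (S T : {set V}) (x : V) : S \subset T ->
  degree_in T x = (degree_in S x + degree_in (T :\: S) x)%N.
Proof.
by move=> ST; rewrite /degree_in (big_setID S) /= (setIidPr ST).
Qed.

Lemma sum_degree_in (S T : {set V}) :
  (\sum_(x in S) degree_in T x = \sum_(x in T) degree_in S x)%N.
Proof.
rewrite /degree_in exchange_big /=; apply: eq_bigr => y _.
by apply: eq_bigr => x _; rewrite adj_sym.
Qed.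

Lemma degree_in_lt (S : {set V}) (x : V) : x \in S -> (degree_in S x < #|S|)%N.
Proof.
move=> xS; rewrite degree_in_card (cardsD1 x S) xS ltnS subset_leq_card //.
apply/subsetP => y; rewrite !inE => /andP[-> xy]; rewrite andbT.
by apply: contraTneq xy => ->; rewrite adj_irrefl.
Qed.

Lemma degree_in_gt0 (S : {set V}) (x : V) :
  (0 < degree_in S x)%N -> exists2 y, y \in S & G x y.
Proof.
by rewrite degree_in_card => /card_gt0P[y]; rewrite inE => /andP[]; exists y.
Qed.

Lemma degree_in_gt1 (S : {set V}) (x z : V) :
  (1 < degree_in S x)%N -> exists y, [/\ y \in S, G x y & y != z].
Proof.
rewrite degree_in_card => /card_gt1P[y1 [y2 []]]; rewrite !inE.
move=> /andP[y1S xy1] /andP[y2S xy2] y12.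
have [y1z|y1z] := eqVneq y1 z; last by exists y1.
by exists y2; split=> //; rewrite -y1z eq_sym.
Qed.

(** Edges inside [W :\: S] contribute at most those of a complete graph. Every other edge of [W]
    meets [S], contributes 2, and is counted at least once in the degree sum over [S]. *)
Lemma sum_degree_inD (S W : {set V}) : S \subset W ->
  (\sum_(x in W) degree_in W x <=
   #|W :\: S| * #|W :\: S|.-1 + 2 * \sum_(x in S) degree_in W x)%N.
Proof.
move=> SW; rewrite (big_setID S) /= (setIidPr SW).
under [X in (_ + X)%N]eq_bigr do rewrite (degree_inD _ SW).
rewrite big_split /= (sum_degree_in _ S) mulSn mul1n addnA addnC leq_add //.
  rewrite -sum_nat_const; apply: leq_sum => x xD.
  by rewrite -ltnS (ltn_predK (degree_in_lt xD)) degree_in_lt.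
rewrite leq_add2l; apply: leq_sum => x _.
by rewrite [leqRHS](degree_inD _ SW) leq_addl.
Qed.

(** Coarser on [W :\: S] but with the sum over [S] taken only once, which is the better bound when
    [S] is large. *)
Lemma sum_degree_in_leq (S W : {set V}) : S \subset W ->
  (\sum_(x in W) degree_in W x <=
   #|W :\: S| * #|W|.-1 + \sum_(x in S) degree_in W x)%N.
Proof.
move=> SW; rewrite (big_setID S) /= (setIidPr SW) addnC leq_add2r.
rewrite -sum_nat_const; apply: leq_sum => x; rewrite inE => /andP[_ xW].
by rewrite -ltnS (ltn_predK (degree_in_lt xW)) degree_in_lt.
Qed.

(** An edge is at [v], between [U] and [W], inside [U] or inside [W]. The first two kinds are
    counted once and hence doubled; the last two sums already count every edge twice. *)
Lemma sum_degree_star (v : V) (W U : {set V}) :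
  W = [set z | G v z] -> U = ~: (v |: W) ->
  (\sum_x degree G x = 2 * #|W| + 2 * \sum_(u in U) degree_in W u +
     \sum_(u in U) degree_in U u + \sum_(w in W) degree_in W w)%N.
Proof.
move=> WE UE.
have vW : v \notin W by rewrite WE inE adj_irrefl.
have TE : setT = [set v] :|: (W :|: U) by rewrite UE setUA setUCr.
have dv : [disjoint [set v] & W :|: U].
  by rewrite disjoints1 UE !inE eqxx (negbTE vW).
have dW : [disjoint W & U].
  by rewrite UE disjoints_subset setCK subsetUr.
have degE x : degree G x = (G x v + degree_in W x + degree_in U x)%N.
  by rewrite -degree_inT TE !degree_inU // degree_in_set1 addnA.
have -> : (\sum_x degree G x =
    degree G v + (\sum_(x in W) degree G x + \sum_(x in U) degree G x))%N.
  rewrite (bigD1 v) //= -bigU //; congr (_ + _)%N; apply: eq_bigl => x.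
  rewrite UE !inE negb_or.
  by case: eqP => [->|_]; case: (boolP (_ \in _)) => // /(negP vW).
rewrite /degree -WE.
have -> : (\sum_(x in W) #|[set w | G x w]| =
    #|W| + \sum_(x in W) degree_in W x + \sum_(x in U) degree_in W x)%N.
  rewrite -(sum_degree_in W U) -sum1_card -!big_split /=; apply: eq_bigr => x xW.
  by rewrite -/(degree G x) degE; move: xW; rewrite WE inE adj_sym => ->.
have -> : (\sum_(x in U) #|[set w | G x w]| =
    \sum_(x in U) degree_in W x + \sum_(x in U) degree_in U x)%N.
  rewrite -big_split /=; apply: eq_bigr => x xU.
  rewrite -/(degree G x) degE; move: xU; rewrite UE WE !inE negb_or adj_sym.
  by case/andP=> _ /negbTE ->.
lia.
Qed.

End DegreeIn.

(** * Three-hub trees when [v] misses two vertices *)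

Section TwoNonneighbours.

Variables (V : finType) (G : sgraph V).
Hypothesis V8 : (8 <= #|V|)%N.

Lemma neighbours_hub_hist (v w1 w2 u1 u2 : V) :
  uniq [:: v; u1; u2] -> (forall z, G v z = (z \notin [:: v; u1; u2])) ->
  G v w1 -> G v w2 -> G w1 u1 -> G w2 u2 -> w1 != w2 ->
  (1 < degree_in G [set z | G v z] w1)%N ->
  (0 < degree_in G [set z | G v z] w2)%N -> has_hist G.
Proof.
rewrite /= !inE negb_or -andbA => /and4P[/neqF vu1 /neqF vu2 /neqF u12 _].
move=> vG vw1 vw2 w1u1 w2u2 /neqF w12 d1 d2.
have vGN z : G v z -> [/\ z != v, z != u1 & z != u2].
  by rewrite vG !inE !negb_or => /and3P.
have [/neqF w1v /neqF w1u /neqF w1u'] := vGN _ vw1.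
have [/neqF w2v /neqF w2u /neqF w2u'] := vGN _ vw2.
have neqE := (u12, vu1, vu2, w12, (w1v, w1u, w1u'), (w2v, w2u, w2u')).
have vG' z s : {subset [:: v; u1; u2] <= s} -> z \notin s -> G v z.
  by move=> sub; rewrite vG; apply: contra; apply: sub.
(* If [w1] and [w2] are adjacent, [w1] can be a child of [w2]: then [w2] carries [u2] and [w1],
   while [w1] carries [u1] and a further neighbour [x]. *)
have [w12G|w12G] := boolP (G w1 w2).
  have [x [+ w1x /neqF xw2]] := degree_in_gt1 w2 d1; rewrite inE => vx.
  have [/neqF xv /neqF xu1 /neqF xu2] := vGN _ vx.
  have /neqF xw1 : x != w1 by apply: contraTneq w1x => ->; rewrite adj_irrefl.
  have neqxE := (neqE, xw2, xv, xu1, xu2, xw1).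
  apply: (@three_hub_hist _ G v V8 w2 w1 u2 w1 u1 x); rewrite ?inE ?neqxE //.
    by rewrite /= !inE !neqxE.
    by rewrite adj_sym.
  by move=> z; apply: vG' => y; rewrite !inE => /or3P[] ->; rewrite ?orbT.
(* Otherwise both hubs hang from [v], each with its missed vertex and a private neighbour; two
   choices for [x1] allow it to avoid [x2]. *)
have [x2 + w2x2] := degree_in_gt0 d2; rewrite inE => vx2.
have [x1 [+ w1x1 /neqF x12]] := degree_in_gt1 x2 d1; rewrite inE => vx1.
have [/neqF x1v /neqF x1u1 /neqF x1u2] := vGN _ vx1.
have [/neqF x2v /neqF x2u1 /neqF x2u2] := vGN _ vx2.
have /neqF x11 : x1 != w1 by apply: contraTneq w1x1 => ->; rewrite adj_irrefl.
have /neqF x22 : x2 != w2 by apply: contraTneq w2x2 => ->; rewrite adj_irrefl.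
have /neqF x1w2 : x1 != w2 by apply: contraTneq w1x1 => ->.
have /neqF x2w1 : x2 != w1.
  by apply: contraTneq w2x2 => ->; rewrite adj_sym.
have neqxE := (neqE, x12, (x1v, x1u1, x1u2), (x2v, x2u1, x2u2),
  x11, x22, x1w2, x2w1).
apply: (@three_hub_hist _ G v V8 w1 w2 u1 x1 u2 x2); rewrite ?inE ?neqxE //.
  by rewrite /= !inE !neqxE.
by move=> z; apply: vG' => y; rewrite !inE => /or3P[] ->; rewrite ?orbT.
Qed.

(** The missed vertex [u1] becomes a hub itself: the hubs form a path [v], [w], [u1], where [w] also
    carries [x], and [u1] carries [u2] and [a]. *)
Lemma nonneighbour_hub_hist (v w x u1 u2 a : V) :
  uniq [:: v; u1; u2] -> (forall z, G v z = (z \notin [:: v; u1; u2])) ->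
  G u1 u2 -> G v w -> G w u1 -> G v x -> G w x ->
  G v a -> G u1 a -> a != w -> a != x -> has_hist G.
Proof.
rewrite /= !inE negb_or -andbA => /and4P[/neqF vu1 /neqF vu2 /neqF u12 _].
move=> vG u12G vw wu1 vx wx va u1a /neqF aw /neqF ax.
have vGN z : G v z -> [/\ z != v, z != u1 & z != u2].
  by rewrite vG !inE !negb_or => /and3P.
have [/neqF wv /neqF wu /neqF wu'] := vGN _ vw.
have [/neqF xv /neqF xu /neqF xu'] := vGN _ vx.
have [/neqF av /neqF au /neqF au'] := vGN _ va.
have /neqF xw : x != w by apply: contraTneq wx => ->; rewrite adj_irrefl.
have neqE := (u12, vu1, vu2, aw, ax, (wv, wu, wu'), (xv, xu, xu'),
  (av, au, au'), xw).
apply: (@three_hub_hist _ G v V8 w u1 x u1 u2 a); rewrite ?inE ?neqE //.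
  by rewrite /= !inE !neqE.
move=> z zN; rewrite vG; apply: contra zN.
by rewrite !inE => /or3P[] ->; rewrite ?orbT.
Qed.

End TwoNonneighbours.

(** * A case split and two counting inequalities *)

Lemma zero_or_le1 (T : finType) (A B : {set T}) (f : T -> nat) :
  (forall x y, x \in A -> y \in B -> f x != 0 -> f y != 0 ->
     f x <= 1 /\ f y <= 1)%N ->
  A != set0 -> B != set0 ->
  [\/ {in A, forall x, f x = 0%N}, {in B, forall x, f x = 0%N}
    | {in A :|: B, forall x, f x <= 1}%N].
Proof.
move=> fAB A0 B0.
have [/existsP[x /andP[xA fx]]|/existsPn A0f] :=
  boolP [exists x, (x \in A) && (f x != 0%N)]; last first.
  by constructor 1 => x xA; have := A0f x; rewrite xA negbK => /eqP.
have [/existsP[y /andP[yB fy]]|/existsPn B0f] :=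
  boolP [exists x, (x \in B) && (f x != 0%N)]; last first.
  by constructor 2 => z zB; have := B0f z; rewrite zB negbK => /eqP.
(* Any nonzero value is paired with the nonzero value found on the other side. *)
constructor 3 => z; rewrite inE => /orP[] zS; have [-> //|fz] := eqVneq (f z) 0%N.
  by have [] := fAB _ _ zS yB fz fy.
by have [] := fAB _ _ xA zS fx fz.
Qed.

(** Here k = |W|, s counts the edges from W to the two missed vertices, e the edge joining these,
    and E is the degree sum inside W. For s >= 4 the bound with factor k - 1 suffices. At s = 2 that
    bound only gives equality, so the bound with factor 2 on F is needed too. *)
Lemma le1_count (k s e E F : nat) :
  (5 <= k -> 2 <= s <= k -> e <= 1 -> F <= s ->
   E <= (k - s) * k.-1 + F -> E <= (k - s) * (k - s).-1 + 2 * F ->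
   2 * k + 2 * s + 2 * e + E < k * k.-1 + 10)%N.
Proof.
move=> k5 /andP[s2 sk] e1 Fs.
have [s4 + _|s4 _] := leqP 4 s.
  have [t kE] : exists t, k = (s + t)%N by exists (k - s)%N; lia.
  have [j jE] : exists j, k = (j + 5)%N by exists (k - 5)%N; lia.
  have -> : (k - s = t)%N by lia.
  have -> : (k.-1 = j + 4)%N by lia.
  have : (4 * j <= s * j)%N by rewrite leq_mul2r s4 orbT.
  rewrite {2}kE mulnDl; lia.
have [j jE] : exists j, k = (j + 5)%N by exists (k - 5)%N; lia.
have [->|->] : (s = 2 \/ s = 3)%N by lia.
  have -> : ((k - 2).-1 = j + 2)%N by lia.
  have -> : (k - 2 = j + 3)%N by lia.
  have -> : (k.-1 = j + 4)%N by lia.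
  rewrite jE; lia.
have -> : ((k - 3).-1 = j + 1)%N by lia.
have -> : (k - 3 = j + 2)%N by lia.
have -> : (k.-1 = j + 4)%N by lia.
rewrite jE; lia.
Qed.

(** Here a vertices of W have no neighbour in W. The left side is at most k (k - 1) + 8 in both
    cases: for a >= 2 by s <= k, and for a = 1 by s = 2. *)
Lemma iso_count (k a s e E : nat) :
  (5 <= k -> 1 <= a <= s -> s <= k -> e <= 1 -> 2 <= a \/ s = 2 ->
   E <= (k - a) * (k - a).-1 ->
   2 * k + 2 * s + 2 * e + E < k * k.-1 + 10)%N.
Proof.
move=> k5 /andP[a1 as_] sk e1 a2 leE.
have [j jE] : exists j, k = (j + 5)%N by exists (k - 5)%N; lia.
have kE : (k.-1 = j + 4)%N by lia.
have [a2'|a2'] := leqP 2 a.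
  have {}leE : (E <= (j + 3) * (j + 2))%N.
    by apply: leq_trans leE _; apply: leq_mul; lia.
  rewrite kE jE; nia.
have {}leE : (E <= (j + 4) * (j + 3))%N.
  by apply: leq_trans leE _; apply: leq_mul; lia.
rewrite kE jE; nia.
Qed.

(** * Vertices missing one or two others in a dense graph *)

Section FewNonneighbours.

Variables (V : finType) (G : sgraph V) (v : V).
Hypothesis V8 : (8 <= #|V|)%N.
Hypothesis min_degree : forall x, (1 < degree G x)%N.
Hypothesis dense : ((#|V| - 3) * (#|V| - 4) + 10 <= \sum_x degree G x)%N.

Let W := [set z | G v z].

Let degree_split (U : {set V}) (x : V) : U = ~: (v |: W) -> x \in U ->
  degree G x = (degree_in G W x + degree_in G U x)%N.
Proof.
move=> UE xU; have := xU; rewrite {1}UE !inE negb_or adj_sym => /andP[_ /negbTE xv].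
rewrite -degree_inT (degree_inD G x (subsetT (v |: W))) setTD -UE.
rewrite (degree_inD G x (subsetUl [set v] W)) degree_in_set1 xv.
by rewrite setU1K // inE adj_irrefl.
Qed.

(** A neighbour of the missed vertex [u] with a neighbour [x] in [W] could serve as a second hub
    carrying [u] and [x]. So the at least two neighbours of [u] have no neighbour in [W], and there
    are too few edges. *)
Lemma one_nonneighbour_hist : #|~: (v |: W)| = 1%N -> has_hist G.
Proof.
move=> /eqP/cards1P[u UE]; apply: contrapT => noH.
have vW : v \notin W by rewrite inE adj_irrefl.
have vG z : G v z = (z \notin [:: v; u]).
  move/setP/(_ z): UE; rewrite !inE.
  by case: eqP => [->|_] /=; [rewrite adj_irrefl|move=> <-; rewrite negbK].
have vu : v != u.
  by move/setP/(_ u): UE; rewrite !inE eqxx negb_or eq_sym => /andP[].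
have := sum_degree_star (erefl W) (esym UE).
have uU : u \in [set u] by rewrite inE.
have := min_degree u; rewrite (degree_split (esym UE) uU).
rewrite !big_set1 !degree_in_set1 adj_irrefl addn0.
pose A := [set w in W | G u w].
have AW : A \subset W by apply/subsetP => w; rewrite !inE => /andP[].
have A0 w : w \in A -> degree_in G W w = 0%N.
  rewrite !inE => /andP[vw uw]; apply/eqP; rewrite -leqn0 leqNgt; apply/negP.
  move=> /degree_in_gt0[x]; rewrite inE => vx wx; apply: noH.
  have [wv wu] : w != v /\ w != u by move: vw; rewrite vG !inE negb_or => /andP.
  have [xv xu] : x != v /\ x != u by move: vx; rewrite vG !inE negb_or => /andP.
  have xw : x != w by apply: contraTneq wx => ->; rewrite adj_irrefl.
  apply: (@two_hub_hist _ G v V8 w u x); rewrite // 1?adj_sym //.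
    rewrite /= !inE ![_ == x]eq_sym ![v == _]eq_sym !negb_or.
    by rewrite wv [u == v]eq_sym vu xv wu xw xu.
  by move=> z; rewrite vG; apply: contra; rewrite !inE => /orP[] ->; rewrite ?orbT.
have := sum_degree_inD G AW; rewrite [X in (2 * X)%N]big1 //.
rewrite degree_in_card -/A; have := subset_leq_card AW.
rewrite cardsD (setIidPr AW); have := cardsC (v |: W).
rewrite UE cards1 cardsU1 vW.
move: dense; move: (\sum_x _)%N (\sum_(x in W) _)%N #|W| #|A| #|V| V8 => D E k a n.
(* With n = k + 2 and 2 <= a <= k, the contradiction is 2 k + 2 a + (k - a) (k - a - 1) < (k - 1) (k
   - 2) + 10; the left side is convex in a, so the extreme cases are a = 2 and a = k. *)
nia.
Qed.

Lemma two_nonneighbours_hist : #|~: (v |: W)| = 2%N -> has_hist G.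
Proof.
move=> /eqP/cards2P[u1 [u2 [u12 UE]]]; apply: contrapT => noH.
have vW : v \notin W by rewrite inE adj_irrefl.
have vG z : G v z = (z \notin [:: v; u1; u2]).
  move/setP/(_ z): UE; rewrite !inE.
  by case: eqP => [->|_] /=; [rewrite adj_irrefl|move=> <-; rewrite negbK].
have uniq_vu : uniq [:: v; u1; u2].
  move/setP: UE => UE; have := UE u1; have := UE u2; rewrite /= !inE !eqxx orbT /=.
  by rewrite ![v == _]eq_sym !negb_or => /andP[-> _] /andP[-> _]; rewrite u12.
pose A := [set w in W | G u1 w]; pose B := [set w in W | G u2 w].
have AW : A \subset W by apply/subsetP => w; rewrite !inE => /andP[].
have BW : B \subset W by apply/subsetP => w; rewrite !inE => /andP[].
have ABW : A :|: B \subset W by rewrite subUset AW.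
have vG' z : G v z = (z \notin [:: v; u2; u1]).
  by rewrite vG !inE !negb_or [X in _ && X]andbC.
have uniq_vu' : uniq [:: v; u2; u1].
  by move: uniq_vu; rewrite /= !inE orbC [u1 == u2]eq_sym.
(* A common neighbour in [W] could be a second hub carrying both missed vertices. *)
have disjAB : A :&: B = set0.
  apply/setP => w; rewrite !inE; apply/negP => /andP[/andP[vw u1w] /andP[_ u2w]].
  apply: noH; move: uniq_vu vw; rewrite /= vG !inE !negb_or -!andbA.
  move=> /and4P[vu1 vu2 _ _] /and3P[wv wu1 wu2].
  apply: (@two_hub_hist _ G v V8 w u1 u2); rewrite 1?adj_sym //.
    by rewrite /= !inE !negb_or [v == w]eq_sym wv vu1 vu2 wu1 wu2 u12.
  by move=> z; rewrite vG.
have cardAB : (#|A :|: B| = #|A| + #|B|)%N.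
  by rewrite cardsU disjAB cards0 subn0.
have pairAB x y : x \in A -> y \in B -> degree_in G W x != 0%N ->
    degree_in G W y != 0%N -> (degree_in G W x <= 1 /\ degree_in G W y <= 1)%N.
  move=> xA yB; have xy : x != y.
    apply: contraTneq xA => ->; apply/negP => yA.
    by move/setP/(_ y): disjAB; rewrite in_setI yA yB inE.
  move: xA yB; rewrite -!lt0n !inE => /andP[vx u1x] /andP[vy u2y] dx dy.
  split; rewrite leqNgt; apply/negP => d1; apply: noH.
    by apply: (neighbours_hub_hist V8 uniq_vu vG vx vy _ _ xy d1 dy);
      rewrite adj_sym.
  apply: (neighbours_hub_hist V8 uniq_vu' vG' vy vx _ _ _ d1 dx);
    by rewrite 1?adj_sym // eq_sym.
(* To make [s1] a hub below [w] one needs [x] in [W] adjacent to [w] and another neighbour [a] of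
   [s1] in [W], with [x] and [a] distinct. If |S| = 2 then [a] is forced and [x] must avoid it; if
   |S| > 2 then [x] is arbitrary and [a] avoids it. *)
have nonnb (s1 s2 : V) (S := [set w in W | G s1 w]) :
    uniq [:: v; s1; s2] -> (forall z, G v z = (z \notin [:: v; s1; s2])) ->
    G s1 s2 -> forall w, w \in S ->
    (#|S| = 2 -> degree_in G W w <= 1)%N /\ (2 < #|S| -> degree_in G W w = 0)%N.
  move=> us vs s12 w; rewrite !inE => /andP[vw s1w].
  have s1w' : G w s1 by rewrite adj_sym.
  split=> [S2|S3].
    rewrite leqNgt; apply/negP => d1; apply: noH.
    have /card_gt1P[y1 [y2 [y1S y2S y12]]] : (1 < #|S|)%N by rewrite S2.
    have [a aS aw] : exists2 a, a \in S & a != w.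
      by have [y1w|] := eqVneq y1 w; [exists y2; rewrite // -y1w eq_sym|exists y1].
    move: aS; rewrite !inE => /andP[va s1a].
    have [x [+ wx xa]] := degree_in_gt1 a d1; rewrite inE => vx.
    apply: (nonneighbour_hub_hist V8 us vs s12 vw s1w' vx wx va s1a aw).
    by rewrite eq_sym.
  apply/eqP; rewrite -leqn0 leqNgt; apply/negP => /degree_in_gt0[x].
  rewrite inE => vx wx; apply: noH.
  have [a /andP[aS /andP[aw ax]]] : exists a, (a \in S) && ((a != w) && (a != x)).
    apply/existsP; apply: contraT => /existsPn H.
    have : (#|S| <= #|[set w; x]|)%N.
      apply/subset_leq_card/subsetP => z zS.
      by have := H z; rewrite zS !inE; do 2!case: eqP.
    by rewrite cards2 leqNgt (leq_trans _ S3) // ltnS; case: (_ != _).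
  move: aS; rewrite !inE => /andP[va s1a].
  exact: (nonneighbour_hub_hist V8 us vs s12 vw s1w' vx wx va s1a aw ax).
have := sum_degree_star (erefl W) (esym UE).
have u1U : u1 \in [set u1; u2] by rewrite !inE eqxx.
have u2U : u2 \in [set u1; u2] by rewrite !inE eqxx orbT.
have := min_degree u1; rewrite (degree_split (esym UE) u1U).
have := min_degree u2; rewrite (degree_split (esym UE) u2U).
have dUE x : degree_in G [set u1; u2] x = (G x u1 + G x u2)%N.
  by rewrite /degree_in big_setU1 ?inE //= big_set1.
rewrite !big_setU1 ?inE //= !big_set1 !dUE !adj_irrefl [G u2 u1]adj_sym addn0 add0n.
rewrite !degree_in_card -/A -/B.
move=> dB dA sumE.
have kE : (#|W| + 3 = #|V|)%N.
  by rewrite -(cardsC (v |: W)) UE cards2 u12 cardsU1 vW; clear; lia.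
have iso_bound (S : {set V}) : S \subset W ->
    {in S, forall x, degree_in G W x = 0}%N ->
    (\sum_(x in W) degree_in G W x <= (#|W| - #|S|) * (#|W| - #|S|).-1)%N.
  move=> SW S0; have := sum_degree_inD G SW.
  by rewrite [X in (2 * X)%N]big1 // cardsD (setIidPr SW) muln0 addn0.
have sW := subset_leq_card ABW; rewrite cardAB in sW.
have W5 : (5 <= #|W|)%N by move: V8; rewrite -kE !addnS addn0 !ltnS.
have e1 : (G u1 u2 <= 1)%N by case: (G u1 u2).
have sum_ge : (#|W| * #|W|.-1 + 10 <= 2 * #|W| + 2 * (#|A| + #|B|) +
    2 * G u1 u2 + \sum_(w in W) degree_in G W w)%N.
  have nE : (#|V| - 3 = #|W|)%N by rewrite -kE addnK.
  have nE' : (#|V| - 4 = #|W|.-1)%N by rewrite -kE; clear; lia.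
  by move: dense; rewrite nE nE' sumE; clear; lia.
have isoA : {in A, forall x, degree_in G W x = 0}%N -> (2 <= #|A|)%N -> False.
  move=> /(iso_bound _ AW) leE a2; move: sum_ge; apply/negP; rewrite -ltnNge.
  by apply: (iso_count W5 _ sW e1 _ leE); [rewrite (ltnW a2) leq_addr|left].
have isoB : {in B, forall x, degree_in G W x = 0}%N -> (2 <= #|B|)%N -> False.
  move=> /(iso_bound _ BW) leE b2; move: sum_ge; apply/negP; rewrite -ltnNge.
  by apply: (iso_count W5 _ sW e1 _ leE); [rewrite (ltnW b2) leq_addl|left].
have le1AB : {in A :|: B, forall x, degree_in G W x <= 1}%N -> False.
  move=> le1; have le_s : (\sum_(x in A :|: B) degree_in G W x <= #|A| + #|B|)%N.
    by rewrite -cardAB -sum1_card; apply: leq_sum => x /le1.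
  have := sum_degree_inD G ABW; have := sum_degree_in_leq G ABW.
  rewrite cardsD (setIidPr ABW) cardAB => leE leE'.
  move: sum_ge; apply/negP; rewrite -ltnNge.
  by apply: (le1_count W5 _ e1 le_s leE leE'); rewrite sW; clear -dA dB e1; lia.
have A0 : A != set0 by rewrite -card_gt0; clear -dA e1; lia.
have B0 : B != set0 by rewrite -card_gt0; clear -dB e1; lia.
(* A missed vertex with a single neighbour in [W] owes its second neighbour to the other missed
   vertex. *)
have u12adj : (#|A| < 2)%N || (#|B| < 2)%N -> G u1 u2.
  by case: (G u1 u2) dA dB => //; rewrite !addn0 !ltnNge => -> ->.
(* If [A] has no edges into [W], only |A| = 1 remains, and then [u1] and [u2] are adjacent. So
   [nonnb] applies to [B]: size 3 or more makes [B] isolated in [W], size 2 bounds its degrees by 1,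
   and size 1 is the case s = 2 of [iso_count]. *)
have [isA|isB|//] := zero_or_le1 pairAB A0 B0.
  have [a2|a2] := leqP 2 #|A|; first exact: isoA.
  have G21 : G u2 u1 by rewrite adj_sym u12adj ?a2.
  have nB := nonnb _ _ uniq_vu' vG' G21.
  have [b3|b3] := leqP 3 #|B|; first by apply: isoB => [w /nB[_ ->]|] //; exact: ltnW.
  have [b2|b2] := eqVneq #|B| 2%N.
    by apply: le1AB => w; rewrite inE => /orP[/isA->//|/nB[->]].
  move: sum_ge; apply/negP; rewrite -ltnNge.
  by apply: (iso_count W5 _ sW e1 _ (iso_bound _ AW isA));
    [|right]; clear -dA dB e1 a2 b2 b3; lia.
have [b2|b2] := leqP 2 #|B|; first exact: isoB.
have G12 : G u1 u2 by rewrite u12adj ?b2 ?orbT.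
have nA := nonnb _ _ uniq_vu vG G12.
have [a3|a3] := leqP 3 #|A|; first by apply: isoA => [w /nA[_ ->]|] //; exact: ltnW.
have [a2|a2] := eqVneq #|A| 2%N.
  by apply: le1AB => w; rewrite inE => /orP[/nA[->]|/isB->].
move: sum_ge; apply/negP; rewrite -ltnNge.
by apply: (iso_count W5 _ sW e1 _ (iso_bound _ BW isB));
  [|right]; clear -dA dB e1 a2 b2 a3; lia.
Qed.

End FewNonneighbours.

(** * Case distinction on the number of vertices that [v] misses *)

Theorem corollary1p4 (R : realType) (n : nat) (V : finType) (G : sgraph V)
    (hn : (8 <= n)%N) (hV : #|V| = n) (hG : two_connected G)
    (hrho : n%:R - 4 + 2 / (n%:R - 4) <= spectral_radius R G) :
  has_hist G.
Proof.
have min_deg := two_connected_min_degree hG.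
rewrite -{}hV in hn hrho.
have [eig_rho _] := spectral_radiusP R G (leq_trans (isT : 0 < 8)%N hn).
have [[v deg_v] dense] := spectral_degree_bounds min_deg hn eig_rho hrho.
have cardU := cardsC (v |: [set z | G v z]).
rewrite cardsU1 inE adj_irrefl -/(degree G v) in cardU.
have : (#|~: (v |: [set z | G v z])| <= 2)%N.
  by move: deg_v; rewrite -cardU; clear; lia.
rewrite leq_eqVlt => /predU1P[U2|]; first exact: two_nonneighbours_hist U2.
rewrite ltnS leq_eqVlt => /predU1P[U1|]; first exact: one_nonneighbour_hist U1.
rewrite ltnS leqn0 cards_eq0 => /eqP/setP U0.
apply: (star_hist (v := v)) => // z /negbTE zv.
by have := U0 z; rewrite !inE zv => /negbFE.
Qed.
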